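(* Let $\Gamma$ be a finite connected bipartite graph and let $v\in V(\Gamma)$ be a vertex. Then there exists an algorithm which determines a spanning tree $T$ of $\Gamma$ that is a co-tree edge alternating spanning tree with respect to the depth labeling $\mu_v:E(T)\to\{+,-\}$. (In particular such a spanning tree $T$ exists for every such $\Gamma$ and every $v$.)
   Context: Let $T$ be a spanning tree of a connected graph $\Gamma$. A co-tree edge is an edge $e\in E(\Gamma)\setminus E(T)$. A labeling $\mu:E(T)\to\{+,-\}$ is called alternating if for every co-tree edge $e$, the unique path $v_0,v_1,\dots,v_\ell$ in $T$ joining the two end vertices of $e$ satisfies $\mu(v_iv_{i+1})\neq\mu(v_{i+1}v_{i+2})$ for all $i=0,1,\dots,\ell-2$. The spanning tree $T$ is a co-tree edge alternating spanning tree with respect to $\mu$ if $\mu$ is alternating. Depth labeling: fix a vertex $v$ (the root). The depth $d(u)$ of a vertex $u$ is the distance between $u$ and $v$ in $T$. The depth $d(e)$ of an edge $e=\{v_i,v_j\}\in E(T)$ is $\max\{d(v_i),d(v_j)\}$. The depth labeling $\mu_v:E(T)\to\{+,-\}$ assigns to $e$ the sign of $(-1)^{d(e)}$. *)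

(* Defs.v *)
From mathcomp Require Import all_boot.

Set Implicit Arguments.
Unset Strict Implicit.
Unset Printing Implicit Defensive.

(* Finite simple graphs on a finType V are adjacency relations.               *)

Section Graphs.

Variable V : finType.
Implicit Types (e t : rel V) (u v x y : V).

Definition simple_graph e : Prop := symmetric e /\ irreflexive e.

Definition connected_graph e : Prop := forall x y, connect e x y.

Definition bipartite_graph e : Prop :=
  exists A : {set V}, forall x y, e x y -> (x \in A) != (y \in A).

(* A cycle has at least three, pairwise distinct, vertices: for a symmetric   *)
(* relation, a two-element ucycle is just an edge.                            *)
Definition acyclic_graph e : Prop :=
  forall c : seq V, ucycle e c -> size c <= 2.

Definition spanning_tree e t : Prop :=
  [/\ symmetric t, subrel t e, connected_graph t & acyclic_graph t].

(* The least length of a t-walk from x to y, and #|V| if there is none.       *)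
Definition dist t x y : nat :=
  find (fun n => [exists p : n.-tuple V, path t x p && (last x p == y)])
       (iota 0 #|V|).

Inductive sign : Type := Plus | Minus.

(* A labeling of E(T) is given on all sets of vertices; only its values on    *)
(* the edges [set x; y] of T are ever used.                                   *)
Definition labeling : Type := {set V} -> sign.

Definition edge_depth t v (E : {set V}) : nat := \max_(u in E) dist t u v.

Definition depth_labeling t v : labeling :=
  fun E => if odd (edge_depth t v E) then Minus else Plus.

(* The path v_0, ..., v_l is x :: p, so that l = size p; when t is a tree     *)
(* there is exactly one such p for given x and y.                             *)
Definition alternating e t (mu : labeling) : Prop :=
  forall x y, e x y -> ~~ t x y ->
  forall p : seq V, path t x p -> last x p = y -> uniq (x :: p) ->
  let w i := nth x (x :: p) i in
  forall i, i.+2 <= size p ->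
    mu [set w i; w i.+1] <> mu [set w i.+1; w i.+2].

Definition cotree_edge_alternating_spanning_tree e t (mu : labeling) : Prop :=
  spanning_tree e t /\ alternating e t mu.

(* The adjacency matrix, with vertices in the order of enum V, read as a      *)
(* number in binary: bit i * #|V| + j is the entry in row i and column j.     *)
Definition graph_code e : nat :=
  \sum_(x : V) \sum_(y : V | e x y) 2 ^ (enum_rank x * #|V| + enum_rank y).

End Graphs.

(* Algorithms are programs for partial recursive functions.  A program takes  *)
(* a list of numbers; it diverges when no rule of computes applies.           *)

Inductive program : Type :=
| Zero
| Succ
| Proj of nat
| Comp of program & seq program
| PrimRec of program & program
| Mu of program.

(* computes a xs y: on input xs, the program a halts with output y.           *)
Inductive computes : program -> seq nat -> nat -> Prop :=
| computes_zero xs : computes Zero xs 0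
| computes_succ n xs : computes Succ (n :: xs) n.+1
| computes_proj i xs : i < size xs -> computes (Proj i) xs (nth 0 xs i)
| computes_comp f gs xs ys z :
    size ys = size gs ->
    (forall i, i < size gs -> computes (nth Zero gs i) xs (nth 0 ys i)) ->
    computes f ys z ->
    computes (Comp f gs) xs z
| computes_rec0 f g xs y :
    computes f xs y -> computes (PrimRec f g) (0 :: xs) y
| computes_recS f g n xs y z :
    computes (PrimRec f g) (n :: xs) y -> computes g [:: n, y & xs] z ->
    computes (PrimRec f g) (n.+1 :: xs) z
| computes_mu f xs n (val : nat -> nat) :
    (forall m, m < n -> computes f (m :: xs) (val m).+1) ->
    computes f (n :: xs) 0 ->
    computes (Mu f) xs n.

Lemma computes_det a xs y z : computes a xs y -> computes a xs z -> y = z.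
Proof.
move=> ay; elim: ay z => {a xs y}.
- by move=> xs z H; inversion H.
- by move=> n xs z H; inversion H.
- by move=> i xs _ z H; inversion H.
- move=> f gs xs ys y eq_sz _ IHgs _ IHf z H.
  inversion H as [| | |f' gs' xs' ys' z' eq_sz' cgs cf| | |]; subst.
  suff eq_ys : ys = ys' by apply: IHf; rewrite eq_ys.
  apply: (@eq_from_nth _ 0) => [|i lti]; first by rewrite eq_sz eq_sz'.
  by rewrite eq_sz in lti; apply: IHgs => //; apply: cgs.
- by move=> f g xs y _ IH z H; inversion H; subst; apply: IH.
- move=> f g n xs y z _ IHn _ IHg z' H.
  inversion H as [| | | | |f' g' n' xs' y' z'' cn cg|]; subst.
  by apply: IHg; rewrite (IHn _ cn).
- move=> f xs n val _ IHlt _ IHn n' H.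
  inversion H as [| | | | | |f' xs' n'' val' clt cn]; subst.
  case: (ltngtP n n') => // lt_n.
    by have := IHn _ (clt _ lt_n).
  by have := IHlt _ lt_n _ cn.
Qed.

(* Main.v *)
(* A spanning tree is given by a parent function f fixing the root v.  Call f *)
(* normal when the ends of every edge of the graph lie on one branch, as in a *)
(* depth-first search tree.  The tree path joining the ends of a co-tree edge *)
(* is then monotone in depth, so the depth labels along it alternate.  A      *)
(* normal parent function exists: take one with maximal sum of depths.        *)
(* The algorithm searches for the least number whose base-#|V| digits are the *)
(* values of a normal parent function, a primitive recursive condition, and   *)
(* outputs the code of its tree.                                              *)
Require Import Defs.
From mathcomp Require Import all_boot.

Set Implicit Arguments.
Unset Strict Implicit.
Unset Printing Implicit Defensive.

(** In the tree of a parent function, a path without backtracking that has once stepped from parent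
    to child keeps descending ([path_descends]), so every path climbs and then descends. If both
    phases occur, the ends of the path lie below different children of its highest vertex; normality
    forbids this when the ends are joined by an edge of the graph. Such a path is therefore
    monotone, and edge depth changes by exactly one at each step ([normal_alternating]).

    For existence, suppose an edge joins [x] and [y] on different branches, with [y] no deeper than
    [x]. Making [x] the parent of [y] lowers no level and raises that of [y] ([level_reparent]), so
    a parent function with maximal level sum is normal ([exists_normal_parent_function]).

    For the algorithm, every self-map of the vertices has a code and every number codes some
    self-map ([exists_code], [exists_coded]). Normality is a condition on digits with bounded
    quantifiers ([normal_codeE]), so the search halts, and whatever number it finds codes a normal
    parent function; [tree_codeE] then gives the output. *)

Lemma eq_findex (T : finType) (f g : T -> T) : f =1 g -> findex f =2 findex g.
Proof.
move=> fg x y; rewrite /findex /orbit /order (eq_card (eq_fconnect fg x)).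
by congr index; move: #|fconnect g x| => n; elim: n x => //= n IHn x; rewrite fg IHn.
Qed.

(** * Parent functions, their trees and their depths *)

Section ParentFunctions.

Variables (V : finType) (e : rel V) (v : V).
Implicit Types (f : V -> V) (x y z : V).

Definition parent_function f : bool :=
  [&& f v == v, [forall x, (x != v) ==> e x (f x)] & [forall x, fconnect f x v]].

Definition normal_parent_function f : bool :=
  parent_function f &&
  [forall x, forall y, e x y ==> fconnect f x y || fconnect f y x].

(** The conjunct [x != y] removes the loop that the fixed point [f v = v] would create at the
    root. *)
Definition parent_tree f : rel V :=
  fun x y => (x != y) && ((f x == y) || (f y == x)).

Definition level f x : nat := findex f x v.

Lemma parent_functionP f :
  reflect [/\ f v = v, forall x, x != v -> e x (f x) & forall x, fconnect f x v]
          (parent_function f).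
Proof.
apply: (iffP and3P) => [[/eqP fv /forallP fe /forallP fc]|[fv fe fc]].
  by split=> // x; apply/implyP.
by split; [apply/eqP | apply/forallP=> x; apply/implyP; apply: fe | apply/forallP].
Qed.

Lemma level_root f : level f v = 0.
Proof. exact: findex0. Qed.

Section Level.

Variable f : V -> V.
Hypothesis fP : parent_function f.

Lemma levelS x : x != v -> level f x = (level f (f x)).+1.
Proof. by case/parent_functionP: fP => _ _ fc xv; rewrite /level fconnect_findex // eq_sym. Qed.

Lemma parent_root : f v = v.
Proof. by case/parent_functionP: fP. Qed.

Lemma parent_connect_root x : fconnect f x v.
Proof. by case/parent_functionP: fP. Qed.

Lemma level_parent x : level f (f x) = (level f x).-1.
Proof.
have [->|/levelS ->] := eqVneq x v; last by [].
by rewrite parent_root level_root.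
Qed.

Lemma level_iter_parent n x : level f (iter n f x) = level f x - n.
Proof. by elim: n => [|n IHn]; rewrite ?subn0 // iterS level_parent IHn subnS. Qed.

Lemma level_lt_card x : level f x < #|V|.
Proof. exact: leq_trans (findex_max (parent_connect_root x)) (max_card _). Qed.

Lemma level_gt0 x : (0 < level f x) = (x != v).
Proof. by rewrite lt0n /level findex_eq0. Qed.

(** The root is the only fixed point of [f], because the level drops strictly from any other vertex
    to its parent. *)
Lemma parent_treeP x y :
  reflect ((x != v /\ f x = y) \/ (y != v /\ f y = x)) (parent_tree f x y).
Proof.
have neq z : z != v -> z != f z.
  by move=> zv; apply/eqP=> zfz; have := levelS zv; rewrite -zfz; apply/n_Sn.
apply: (iffP andP) => [[xy /orP[]/eqP def]|[] [xv def]].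
- by left; split=> //; apply: contraNneq xy => xv; rewrite -def xv parent_root.
- by right; split=> //; apply: contraNneq xy => yv; rewrite -def yv parent_root.
- by rewrite -def neq ?eqxx.
by rewrite -def eq_sym neq ?eqxx ?orbT.
Qed.

Lemma parent_tree_sym : symmetric (parent_tree f).
Proof. by move=> x y; rewrite /parent_tree eq_sym orbC. Qed.

Lemma parent_tree_up x : x != v -> parent_tree f x (f x).
Proof. by move=> xv; apply/parent_treeP; left. Qed.

(** The orbit of [x] under [f] is a tree path. It gives connectedness, and the upper bound in
    [dist_level]. *)
Lemma path_to_root x :
  path (parent_tree f) x (behead (traject f x (level f x).+1)) /\
  last x (behead (traject f x (level f x).+1)) = v.
Proof.
move: {2}(level f x) (erefl (level f x)) => n; elim: n x => [|n IHn] x dx.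
  by rewrite dx; split=> //; apply/eqP; rewrite -(findex_eq0 f) -/(level f x) dx.
have xv: x != v by rewrite -level_gt0 dx.
have dfx: level f (f x) = n by rewrite level_parent dx.
by have [] := IHn _ dfx; rewrite dfx dx /= parent_tree_up.
Qed.

Lemma parent_tree_connected : connected_graph (parent_tree f).
Proof.
have cv x : connect (parent_tree f) x v.
  have [pth lst] := path_to_root x; apply/connectP.
  by exists (behead (traject f x (level f x).+1)).
move=> x y; apply: connect_trans (cv x) _.
by rewrite (sym_connect_sym parent_tree_sym).
Qed.

(* A vertex of maximal level on a cycle would have its unique parent as both *)
(* of its neighbours.                                                        *)
Lemma parent_tree_acyclic : acyclic_graph (parent_tree f).
Proof.
case=> [//|x0 c0]; set c := x0 :: c0 => cyc.
have x0c : x0 \in c by rewrite mem_head.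
case: (arg_maxnP (level f) x0c) => x xc xmax.
have [i s def_c] := rot_to xc.
have {cyc}: ucycle (parent_tree f) (x :: s) by rewrite -def_c rot_ucycle.
rewrite -(size_rot i c) def_c => /andP[cyc /andP[_ us]].
move: us cyc xmax.
have down y : parent_tree f x y -> y \in c ->
    (forall j, j \in c -> level f j <= level f x) -> y = f x.
  case/parent_treeP=> [[_ ->] //|[yv fy]] yc /(_ _ yc).
  by rewrite (levelS yv) fy ltnn.
have sc y : y \in s -> y \in c by rewrite -(mem_rot i c) def_c inE orbC => ->.
case: s def_c sc => [|y s] def_c sc //=; case/lastP: s def_c sc => [|s z] def_c sc //=.
rewrite rcons_path last_rcons => /andP[yns _] /and3P[xy _ zx] xmax.
have yc : y \in c by apply: sc; rewrite mem_head.
have zc : z \in c by apply: sc; rewrite inE mem_rcons mem_head orbT.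
case/negP: yns; rewrite (down _ xy) // -(down z) ?mem_rcons ?mem_head //.
by rewrite parent_tree_sym.
Qed.

Lemma parent_tree_sub : symmetric e -> subrel (parent_tree f) e.
Proof.
case/parent_functionP: fP => _ fe _ esym x y /parent_treeP[] [xv <-]; first exact: fe.
by rewrite esym fe.
Qed.

Lemma parent_tree_spanning : symmetric e -> spanning_tree e (parent_tree f).
Proof.
split; [exact: parent_tree_sym | exact: parent_tree_sub
       | exact: parent_tree_connected | exact: parent_tree_acyclic].
Qed.

(** One edge changes the level by one. With the root as last vertex this is the lower bound in
    [dist_level]. *)
Lemma leq_level_path x p : path (parent_tree f) x p -> level f x <= size p + level f (last x p).
Proof.
elim: p x => //= y p IHp x /andP[xy /IHp le_y].
apply: leq_trans (_ : (level f y).+1 <= _); last by rewrite addSn ltnS.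
by case/parent_treeP: xy => [[/levelS -> ->]|[/levelS -> ->]] //; rewrite leqW.
Qed.

Lemma dist_level x : dist (parent_tree f) x v = level f x.
Proof.
set P := fun n => [exists p : n.-tuple V, path (parent_tree f) x p && (last x p == v)].
have Pd : P (level f x).
  have [pth /eqP lst] := path_to_root x; apply/existsP.
  have sz : size (behead (traject f x (level f x).+1)) == level f x.
    by rewrite size_behead size_traject.
  by exists (Tuple sz); rewrite /= in pth lst *; rewrite pth lst.
have Pmin n : P n -> level f x <= n.
  case/existsP=> p /andP[/leq_level_path + /eqP lst].
  by rewrite lst level_root addn0 size_tuple.
(* The search in [dist] only covers lengths below [#|V|], so the level must be below that bound for
   it to succeed. *)
rewrite /dist -/P; have lt_card := level_lt_card x.
apply/eqP; rewrite eqn_leq; apply/andP; split.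
  rewrite leqNgt; apply/negP=> /(before_find 0).
  by rewrite nth_iota // add0n Pd.
have hasP : has P (iota 0 #|V|).
  by apply/hasP; exists (level f x); rewrite // mem_iota.
have := nth_find 0 hasP; rewrite has_find size_iota in hasP.
by rewrite nth_iota // add0n => /Pmin.
Qed.

Lemma edge_depth_parent x :
  x != v -> edge_depth (parent_tree f) v [set x; f x] = level f x.
Proof.
move=> xv; have neq : x != f x.
  by apply/eqP=> xfx; have := levelS xv; rewrite -xfx; apply/n_Sn.
rewrite /edge_depth setUC big_setU1 ?inE 1?eq_sym //= big_set1 !dist_level.
by rewrite level_parent; apply/maxn_idPr/leq_pred.
Qed.

Lemma depth_labeling_parent x : x != v ->
  depth_labeling (parent_tree f) v [set x; f x] = if odd (level f x) then Minus else Plus.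
Proof. by move=> xv; rewrite /depth_labeling edge_depth_parent. Qed.

(** * Paths without backtracking: first up, then down *)

Section UniquePath.

Variables (n : nat) (w : nat -> V).
Hypothesis w_adj : forall i, i < n -> parent_tree f (w i) (w i.+1).
Hypothesis w_inj : forall i, i.+2 <= n -> w i <> w i.+2.

(** The only way up from [w i.+1] leads back to [w i], which [w_inj] excludes; so a descent
    continues. *)
Lemma path_descends i j : i <= j < n -> w i.+1 != v -> f (w i.+1) = w i ->
  w j.+1 != v /\ f (w j.+1) = w j.
Proof.
case/andP=> le_ij; rewrite -(subnK le_ij); elim: (j - i) => // k IHk ltn wv fw.
have [wv' fw'] := IHk (ltnW ltn) wv fw.
case/parent_treeP: (w_adj ltn) => [[_]|[]] //; rewrite addSn fw'.
by move/(w_inj ltn).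
Qed.

Lemma path_ascends i j : j <= i < n -> w i != v -> f (w i) = w i.+1 ->
  w j != v /\ f (w j) = w j.+1.
Proof.
case/andP=> le_ji lt_in wv fw.
case/parent_treeP: (w_adj (leq_ltn_trans le_ji lt_in)) => // -[wv' fw'].
have [|wv2 fw2] := @path_descends j i _ wv' fw'; first by rewrite le_ji.
(* Otherwise [w i] and [w i.+1] would be each other's parents, and the level of [w i] would exceed
   itself by two. *)
by have := levelS wv; rewrite fw (levelS wv2) fw2 => /eqP;
  rewrite -[X in X == _]addn0 -addn2 eqn_add2l.
Qed.

Lemma iter_ascent i : (forall j, j < i -> f (w j) = w j.+1) -> iter i f (w 0) = w i.
Proof. by elim: i => //= i IHi up; rewrite IHi ?up // => j /ltnW; apply: up. Qed.

Lemma iter_descent i j : i <= j -> (forall k, i <= k < j -> f (w k.+1) = w k) ->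
  iter (j - i) f (w j) = w i.
Proof.
move=> /subnK <-; rewrite addnK; elim: (j - i) => // k IHk dn.
rewrite iterSr addSn dn ?leq_addl ?leqnn // IHk // => l /andP[il lk].
by apply: dn; rewrite il (leq_trans lk) // addSn.
Qed.

End UniquePath.

(** On the branch of [x] the level determines the number of iterations of [f], as long as the root
    is not reached; past it, the truncated subtraction in [level_iter_parent] loses this
    information. *)
Lemma branch_eq a b x y : level f (iter a f x) = level f (iter b f y) ->
  iter a f x != v -> fconnect f x y -> iter a f x = iter b f y.
Proof.
move=> eq_lev av /iter_findex; set k := findex f x y => def_y.
move: eq_lev av; rewrite -def_y -iterD !level_iter_parent -level_gt0 level_iter_parent.
move=> eq_lev pos; suff -> : a = b + k by [].
rewrite -(@subKn a (level f x)); last by rewrite ltnW // -subn_gt0.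
by rewrite eq_lev subKn // ltnW // -subn_gt0 -eq_lev.
Qed.

End Level.

Lemma normal_alternating f : normal_parent_function f ->
  alternating e (parent_tree f) (depth_labeling (parent_tree f) v).
Proof.
case/andP=> fP /forallP fanc x y exy _ p pth lst uniq_p w i lt_ip.
have {pth} adj j : j < size p -> parent_tree f (w j) (w j.+1).
  by move=> ltj; apply: (pathP x pth).
have inj j : j.+2 <= size p -> w j <> w j.+2.
  move=> ltj; have ltj' : j < size (x :: p) := leqW (ltnW ltj).
  have ltj2 : j.+2 < size (x :: p) := ltj.
  move/eqP; rewrite (nth_uniq x ltj' ltj2 uniq_p).
  by rewrite -[X in X == _]addn0 -addn2 eqn_add2l.
have lt_ip' := ltnW lt_ip.
have rw (s t : V) : [set s; t] = [set t; s] by rewrite setUC.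
have wn : w (size p) = y by rewrite /w -lst (last_nth x).
case/(parent_treeP fP): (adj _ lt_ip') => -[wv1 fw1];
  case/(parent_treeP fP): (adj _ lt_ip) => -[wv2 fw2].
- rewrite -{1}fw1 -fw2 !depth_labeling_parent // (levelS fP wv1) fw1 /=.
  by case: odd.
- (* Here w (i + 1) is the parent of both neighbours on the path, so x and y *)
  (* lie below distinct children of it, hence on different branches.         *)
  have up : iter i f x = w i.
    apply: (@iter_ascent f w) => j ltj.
    by have [|_ ->] := @path_ascends f fP _ w adj inj i j _ wv1 fw1; rewrite ?(ltnW ltj).
  have down : iter (size p - i.+2) f y = w i.+2.
    rewrite -wn; apply: (@iter_descent f w) => // j.
    case: j => [|j] //; rewrite ltnS => /andP[le_ij ltj].
    have ltij : i.+1 <= j.+1 < size p by rewrite ltnW.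
    by have [_ ->] := @path_descends f fP _ w adj inj i.+1 j.+1 ltij wv2 fw2.
  have eq_lev : level f (w i) = level f (w i.+2).
    by rewrite (levelS fP wv1) (levelS fP wv2) fw1 fw2.
  (* The two children are iterates of [x] and of [y] at the same level; since [x] and [y] lie on one
     branch, [branch_eq] identifies them, contradicting [inj]. *)
  case: (inj _ lt_ip); rewrite -up -down in eq_lev wv1 wv2 *.
  have /implyP/(_ exy)/orP[] := forallP (fanc x) y.
    exact: branch_eq.
  by move=> yx; apply/esym/branch_eq.
- by case: (inj _ lt_ip); rewrite -fw1 -fw2.
rewrite (rw (w i)) (rw (w i.+1) (w i.+2)) -fw1 depth_labeling_parent //.
rewrite -[X in [set w i.+2; X]]fw2 depth_labeling_parent // (levelS fP wv2) fw2 /=.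
by case: odd.
Qed.

(** * Existence of a normal parent function *)

(** Each vertex other than the root takes as parent a neighbour closer to the root, as in
    breadth-first search. This starting point makes the later maximization range over a nonempty
    set. *)
Lemma exists_parent_function : connected_graph e -> exists f, parent_function f.
Proof.
move=> conn.
have walk x : exists n, [exists p : n.-tuple V, path e x p && (last x p == v)].
  have /connectP[p pth lst] := conn x v.
  by exists (size p); apply/existsP; exists (in_tuple p); rewrite /= pth -lst eqxx.
pose D x := ex_minn (walk x).
have closer x : x != v -> exists y, e x y && (D y < D x).
  move=> xv; rewrite /D; case: ex_minnP => [[|n]] /existsP[p /andP[pth lst]] _.
    by rewrite (tuple0 p) (negPf xv) in lst.
  (* Dropping the first step of a shortest walk leaves a shorter walk from a neighbour. *)
  case/tupleP: p pth lst => y p /= /andP[xy pth] lst; exists y; rewrite xy /=.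
  by case: ex_minnP => m _ m_min; rewrite ltnS; apply/m_min/existsP; exists p; rewrite pth.
pose f x := if x == v then v else odflt x [pick y | e x y && (D y < D x)].
have fP x : x != v -> e x (f x) && (D (f x) < D x).
  move=> xv; rewrite /f (negPf xv); case: pickP => //= none.
  by case: (closer x xv) => y; rewrite none.
exists f; apply/parent_functionP; split=> [|x /fP/andP[]//|x]; first by rewrite /f eqxx.
elim/ltn_ind: (D x) {-2}x (erefl (D x)) => n IHn z Dz.
have [->|/fP/andP[_ ltD]] := eqVneq z v; first exact: connect0.
apply: connect_trans (fconnect1 f z) _; apply: IHn (erefl _).
by rewrite -Dz.
Qed.

Section Reparent.

Variables (f : V -> V) (x y : V).
Hypotheses (fP : parent_function f) (exy : e y x).
Hypotheses (nxy : ~~ fconnect f x y).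

(** The whole subtree below [y] moves along with [y]; [nxy] says that [x] is not in that subtree, so
    no cycle arises. *)
Definition reparent z := if z == y then x else f z.

Let yv : y != v.
Proof. by apply: contraNneq nxy => ->; apply: parent_connect_root. Qed.

(** The orbit of [x] avoids [y], hence is unchanged and still reaches the root. Any other orbit
    either avoids [y] too, or passes from [y] to [x]. *)
Lemma reparent_parent_function : parent_function reparent.
Proof.
have [fv fe fc] := parent_functionP _ fP.
have to_x : fconnect reparent x v.
  have /iter_findex <- := fc x; elim: (findex f x v) => [|n IHn]; first exact: connect0.
  apply: connect_trans IHn _; rewrite iterS.
  suff -> : f (iter n f x) = reparent (iter n f x) by apply: fconnect1.
  rewrite /reparent; case: eqP => // def_y; case/negP: nxy.
  by rewrite -def_y fconnect_iter.
apply/parent_functionP; split=> [|z zv|z].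
- by rewrite /reparent eq_sym (negPf yv).
- by rewrite /reparent; case: eqP => [->|_] //; apply: fe.
have := iter_findex (fc z); move: (findex f z v) => n; elim: n z => [|n IHn] z.
  by move=> /= ->; apply: connect0.
rewrite iterSr; have [->|zy] := eqVneq z y => [_|/IHn fzv].
  by apply: connect_trans to_x; have := fconnect1 reparent y; rewrite {2}/reparent eqxx.
by apply: connect_trans fzv; have := fconnect1 reparent z; rewrite {2}/reparent (negPf zy).
Qed.

(** By induction on the new level: [y] gains because its new parent [x] is at least as deep as [y]
    was, and every other vertex keeps its parent, whose level did not drop. *)
Lemma level_reparent z : level f y <= level f x -> level f z + (z == y) <= level reparent z.
Proof.
move=> le_yx; have gP := reparent_parent_function.
have [n] := ubnP (level reparent z); elim: n z => // n IHn z; rewrite ltnS.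
have [->|zv] := eqVneq z v; first by rewrite !level_root eq_sym (negPf yv).
rewrite (levelS gP zv) => /IHn; have [->|zy] := eqVneq z y.
  have -> : reparent y = x by rewrite /reparent eqxx.
  by move=> IH; rewrite addn1 ltnS (leq_trans le_yx) // (leq_trans _ IH) ?leq_addr.
have -> : reparent z = f z by rewrite /reparent (negPf zy).
by move=> IH; rewrite addn0 (levelS fP zv) ltnS (leq_trans _ IH) ?leq_addr.
Qed.

End Reparent.

(* If an edge joins two vertices on different branches, then hanging the     *)
(* upper one below the other increases the sum of the levels; hence a parent *)
(* function that maximizes this sum is normal.                               *)
Lemma exists_normal_parent_function :
  symmetric e -> connected_graph e -> exists f, normal_parent_function f.
Proof.
move=> esym /exists_parent_function[f0 f0P].
(* The maximum is taken over the finite type [{ffun V -> V}], so properties are transported along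
   [finfun]. *)
have pE f : parent_function (finfun f) = parent_function f.
  rewrite /parent_function ffunE; congr [&& _, _ & _]; apply: eq_forallb => x.
    by rewrite ffunE.
  by apply: eq_fconnect => z; rewrite ffunE.
have f0P' : parent_function (finfun f0) by rewrite pE.
case: (@arg_maxnP _ (finfun f0) (fun f : {ffun V -> V} => parent_function f)
         (fun f : {ffun V -> V} => \sum_x level f x) f0P') => f fP fmax.
exists f; apply/andP; split=> //.
have no_gain x y : level f y <= level f x -> e y x -> fconnect f x y || fconnect f y x.
  move=> le_yx eyx; apply: contraT; rewrite negb_or => /andP[nxy _].
  have := fmax (finfun (reparent f x y)); rewrite pE reparent_parent_function // => /(_ isT).
  rewrite /= leqNgt => /negP[].
  have lev z : level (finfun (reparent f x y)) z = level (reparent f x y) z.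
    by apply: eq_findex => u; rewrite ffunE.
  rewrite (eq_bigr _ (fun z _ => lev z)).
  apply: leq_trans (_ : \sum_z (level f z + (z == y)) <= _); last first.
    by apply: leq_sum => z _; apply: level_reparent.
  rewrite big_split /= (bigD1 (P := xpredT) (F := fun z => nat_of_bool (z == y)) y) //=.
  by rewrite eqxx addnA addn1 ltnS leq_addr.
apply/forallP=> x; apply/forallP=> y; apply/implyP=> exy.
case/orP: (leq_total (level f y) (level f x)) => [le_yx|le_xy].
  by apply: no_gain => //; rewrite esym.
by rewrite orbC no_gain.
Qed.

End ParentFunctions.

(** * Closure properties of computable functions *)

(** Correctness is required only on inputs of length [k], so [f] may use list operations whose
    default values on other lengths are irrelevant. *)
Definition computable (k : nat) (f : seq nat -> nat) : Prop :=
  exists A : program, forall xs, size xs = k -> computes A xs (f xs).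

Lemma eq_computable k f g :
  (forall xs, size xs = k -> f xs = g xs) -> computable k f -> computable k g.
Proof. by move=> fg [A Af]; exists A => xs sz; rewrite -fg //; apply: Af. Qed.

Lemma computable_var k i : i < k -> computable k (fun xs => nth 0 xs i).
Proof. by move=> lti; exists (Proj i) => xs sz; constructor; rewrite sz. Qed.

Lemma computable_comp k f (gs : seq (seq nat -> nat)) :
  computable (size gs) f -> (forall i, i < size gs -> computable k (nth (fun=> 0) gs i)) ->
  computable k (fun xs => f [seq g xs | g <- gs]).
Proof.
move=> [A Af] gsP.
have [Bs [szB BsP]] : exists Bs, size Bs = size gs /\ forall i, i < size gs ->
    forall xs, size xs = k -> computes (nth Zero Bs i) xs (nth (fun=> 0) gs i xs).
  elim: gs gsP {f A Af} => [|g gs IHgs] gsP; first by exists [::].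
  have [B BP] := gsP 0 isT; have [Bs [szB BsP]] := IHgs (fun i => gsP i.+1).
  by exists (B :: Bs); rewrite /= szB; split=> // -[_|i lti]; [exact: BP | exact: BsP].
exists (Comp A Bs) => xs sz; apply: (@computes_comp A Bs xs [seq g xs | g <- gs]).
- by rewrite size_map szB.
- by move=> i; rewrite szB => lti; rewrite (nth_map (fun=> 0)) //; apply: BsP.
by apply: Af; rewrite size_map.
Qed.

Lemma computable_comp1 k f a : computable 1 (fun xs => f (nth 0 xs 0)) ->
  computable k a -> computable k (fun xs => f (a xs)).
Proof. by move=> cf ca; apply: (computable_comp (gs := [:: a])) cf _ => -[]. Qed.

Lemma computable_reindex k f (s : seq nat) : computable (size s) f -> all (gtn k) s ->
  computable k (fun xs => f [seq nth 0 xs i | i <- s]).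
Proof.
move=> cf /allP sP; have := @computable_comp k f [seq nth 0 ^~ i | i <- s].
rewrite size_map => /(_ cf) [i lti|A AP].
  by rewrite (nth_map 0) //; apply/computable_var/sP/mem_nth.
by exists A => xs /AP; rewrite -map_comp.
Qed.

(* In the closure lemmas below the bound variable of an iteration, sum or    *)
(* quantifier is the head of the argument list, the parameters its tail.     *)
Lemma computable_head k : computable k.+1 (head 0).
Proof. by apply: eq_computable (computable_var (ltn0Sn k)) => xs _; rewrite nth0. Qed.

Lemma computable_behead k f : computable k f -> computable k.+1 (fun xs => f (behead xs)).
Proof.
rewrite -{1}(size_iota 1 k) => /computable_reindex cf.
apply: eq_computable (cf k.+1 _) => [xs sz|]; last by apply/allP=> i; rewrite mem_iota => /andP[].
by rewrite map_nth_iota ?sz ?subn1 // drop1 take_oversize // size_behead sz.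
Qed.

(** This skips the accumulator, which [PrimRec] passes between the counter and the parameters. *)
Lemma computable_head_behead2 k (f : nat -> seq nat -> nat) :
  computable k.+1 (fun ys => f (head 0 ys) (behead ys)) ->
  computable k.+2 (fun ys => f (head 0 ys) (behead (behead ys))).
Proof.
rewrite -{1}(size_iota 2 k) => cf.
have {cf} := @computable_reindex k.+2 _ (0 :: iota 2 k) cf.
case=> [|A AP]; first by apply/andP; split=> //; apply/allP=> i; rewrite mem_iota => /andP[].
exists A => xs sz; have := AP _ sz; case: xs sz => [|n [|m xs]] //= [sz].
by rewrite map_nth_iota /= ?sz ?subSS ?subn0 // drop0 take_oversize // sz.
Qed.

Lemma computable_const k n : computable k (fun=> n).
Proof.
elim: n => [|n IHn]; first by exists Zero => xs _; constructor.
apply: (computable_comp1 (f := succn)) IHn.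
by exists Succ => -[|x [|]] // _; constructor.
Qed.

Lemma computable_rec k a b (g : nat -> nat -> seq nat -> nat) :
  computable k a -> computable k b ->
  computable k.+2 (fun ys => g (head 0 ys) (head 0 (behead ys)) (behead (behead ys))) ->
  computable k (fun xs => nat_rec (fun=> nat) (b xs) (fun i z => g i z xs) (a xs)).
Proof.
move=> ca [B BP] [G GP].
pose r ys := nat_rec (fun=> nat) (b (behead ys)) (fun i z => g i z (behead ys)) (head 0 ys).
have cr : computable k.+1 r.
  exists (PrimRec B G) => -[|n xs] //= [sz]; elim: n => [|n IHn].
    by constructor; apply: BP.
  apply: computes_recS IHn _; have := GP [:: n, r (n :: xs) & xs]; rewrite /= sz.
  by apply.
(* [PrimRec] counts on its first argument: composing with [a] followed by all projections sets the
   counter to [a xs] and passes the parameters on unchanged. *)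
have := @computable_comp k r (a :: [seq nth 0 ^~ i | i <- iota 0 k]).
rewrite /= size_map size_iota => /(_ cr) [[|i] //= ltik|A AP].
  by rewrite (nth_map 0) ?size_iota // nth_iota //; apply: computable_var.
exists A => xs sz; have := AP _ sz.
by rewrite -map_comp (_ : map _ _ = xs) // -[RHS](mkseq_nth 0) sz.
Qed.

Lemma computable_iter k a b (g : nat -> seq nat -> nat) :
  computable k a -> computable k b ->
  computable k.+1 (fun ys => g (head 0 ys) (behead ys)) ->
  computable k (fun xs => iter (a xs) (g^~ xs) (b xs)).
Proof.
move=> ca cb cg.
apply: eq_computable (computable_rec (g := fun _ z xs => g z xs) ca cb (computable_behead cg)).
by move=> xs _; elim: (a xs) => //= n ->.
Qed.

Lemma computable_succ k a : computable k a -> computable k (fun xs => (a xs).+1).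
Proof. by apply: computable_comp1; exists Succ => -[|x [|]] // _; constructor. Qed.

Lemma computable_pred k a : computable k a -> computable k (fun xs => (a xs).-1).
Proof.
move=> ca.
apply: eq_computable (computable_rec (g := fun i _ _ => i) ca (computable_const k 0) _).
  by move=> xs _; case: (a xs).
exact: computable_head.
Qed.

Lemma computable_add k a b : computable k a -> computable k b ->
  computable k (fun xs => a xs + b xs).
Proof.
move=> ca cb; apply: eq_computable (computable_iter (g := fun z _ => z.+1) cb ca _).
  by move=> xs _; rewrite iter_succn.
exact/computable_succ/computable_head.
Qed.

Lemma computable_sub k a b : computable k a -> computable k b ->
  computable k (fun xs => a xs - b xs).
Proof.
move=> ca cb; apply: eq_computable (computable_iter (g := fun z _ => z.-1) cb ca _).
  by move=> xs _; rewrite iter_predn.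
exact/computable_pred/computable_head.
Qed.

Lemma computable_sum k a (F : nat -> seq nat -> nat) : computable k a ->
  computable k.+1 (fun ys => F (head 0 ys) (behead ys)) ->
  computable k (fun xs => \sum_(i < a xs) F i xs).
Proof.
move=> ca cF.
apply: eq_computable (computable_rec (g := fun i z xs => z + F i xs) ca (computable_const k 0) _).
  move=> xs _; elim: (a xs) => [|n IHn] /=; first by rewrite big_ord0.
  by rewrite big_ord_recr -IHn.
apply: computable_add (computable_head_behead2 cF).
exact/computable_behead/computable_head.
Qed.

Lemma computable_mul k a b : computable k a -> computable k b ->
  computable k (fun xs => a xs * b xs).
Proof.
move=> ca cb; apply: eq_computable (computable_sum (F := fun _ => b) ca (computable_behead cb)).
by move=> xs _; rewrite sum_nat_const card_ord.
Qed.

Lemma computable_exp k a b : computable k a -> computable k b ->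
  computable k (fun xs => a xs ^ b xs).
Proof.
move=> ca cb.
apply: eq_computable (computable_iter (g := fun z xs => a xs * z) cb (computable_const k 1) _).
  by move=> xs _; rewrite iter_muln_1.
exact: computable_mul (computable_behead ca) (computable_head k).
Qed.

(** Booleans count as 0 and 1, and equality is [1 - ((a - b) + (b - a))] with truncated
    subtractions. *)
Lemma computable_eq k a b : computable k a -> computable k b ->
  computable k (fun xs => a xs == b xs).
Proof.
move=> ca cb; apply: eq_computable (computable_sub (computable_const k 1)
  (computable_add (computable_sub ca cb) (computable_sub cb ca))) => xs _.
by rewrite eqn_leq /leq -addn_eq0; case: (_ + _).
Qed.

Lemma computable_leq k a b : computable k a -> computable k b ->
  computable k (fun xs => a xs <= b xs).
Proof. by move=> ca cb; apply: computable_eq (computable_sub ca cb) (computable_const k 0). Qed.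

Lemma computable_neg k (p : seq nat -> bool) : computable k p ->
  computable k (fun xs => ~~ p xs).
Proof.
move=> cp; apply: eq_computable (computable_sub (computable_const k 1) cp) => xs _.
by case: (p xs).
Qed.

Lemma computable_and k (p q : seq nat -> bool) : computable k p -> computable k q ->
  computable k (fun xs => p xs && q xs).
Proof. by move=> cp cq; apply: eq_computable (computable_mul cp cq) => xs _; rewrite mulnb. Qed.

Lemma computable_or k (p q : seq nat -> bool) : computable k p -> computable k q ->
  computable k (fun xs => p xs || q xs).
Proof.
move=> /computable_neg cp /computable_neg cq.
by apply: eq_computable (computable_neg (computable_and cp cq)) => xs _; rewrite -negb_or negbK.
Qed.

Lemma computable_exists k a (p : nat -> seq nat -> bool) : computable k a ->
  computable k.+1 (fun ys => p (head 0 ys) (behead ys)) ->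
  computable k (fun xs => [exists i : 'I_(a xs), p i xs]).
Proof.
move=> ca cp; apply: eq_computable (computable_neg (computable_eq
  (computable_sum (F := fun i xs => nat_of_bool (p i xs)) ca cp) (computable_const k 0))) => xs _.
rewrite sum_nat_eq0; congr nat_of_bool.
by rewrite negb_forall; apply: eq_existsb => i /=; case: (p i xs).
Qed.

Lemma computable_forall k a (p : nat -> seq nat -> bool) : computable k a ->
  computable k.+1 (fun ys => p (head 0 ys) (behead ys)) ->
  computable k (fun xs => [forall i : 'I_(a xs), p i xs]).
Proof.
move=> ca /computable_neg cp.
apply: eq_computable (computable_neg (computable_exists (p := fun i xs => ~~ p i xs) ca cp)) => xs _.
by rewrite -negb_forall negbK.
Qed.

(** The quotient counts the [i < a] with [i.+1 * b <= a]. The extra factor handles [b = 0], where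
    every [i] would count although the quotient is 0. *)
Lemma computable_div k a b : computable k a -> computable k b ->
  computable k (fun xs => a xs %/ b xs).
Proof.
move=> ca cb; have c0 := computable_const k 0.
have cF : computable k.+1 (fun ys => (head 0 ys).+1 * b (behead ys) <= a (behead ys)).
  apply: computable_leq (computable_behead ca).
  exact: computable_mul (computable_succ (computable_head k)) (computable_behead cb).
apply: eq_computable (computable_mul (computable_neg (computable_eq cb c0))
  (computable_sum (F := fun i xs => nat_of_bool (i.+1 * b xs <= a xs)) ca cF)) => xs _.
have [->|] := eqVneq (b xs) 0; first by rewrite divn0.
rewrite -lt0n mul1n => b_gt0.
under eq_bigr => i _ do rewrite -leq_divRL //.
have := leq_div (a xs) (b xs); move: (_ %/ _) => q le_q.
rewrite -[RHS](mul1n q) mulnC -[q in RHS]card_ord -sum_nat_const (big_ord_widen _ (fun=> 1) le_q).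
by rewrite [RHS]big_mkcond; apply: eq_bigr => i _; case: ltnP.
Qed.

Lemma computable_mod k a b : computable k a -> computable k b ->
  computable k (fun xs => a xs %% b xs).
Proof.
move=> ca cb; apply: eq_computable (computable_sub ca (computable_mul (computable_div ca cb) cb)).
by move=> xs _; rewrite {1}(divn_eq (a xs) (b xs)) addnC addnK.
Qed.

(** * Digit codes for graphs and parent functions, and their computability *)

Definition digit B c i := c %/ B ^ i %% B.

Lemma computable_digit k a b c : computable k a -> computable k b -> computable k c ->
  computable k (fun xs => digit (a xs) (b xs) (c xs)).
Proof.
move=> ca cb cc; apply: (computable_mod _ ca); apply: (computable_div cb).
exact: computable_exp.
Qed.

(** The digits of [graph_code] in base [2 ^ n] are the rows of the adjacency matrix, and the bits of
    a row are its entries. *)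
Definition entry n c i j := digit 2 (digit (2 ^ n) c i) j == 1.

Lemma computable_entry k a b c d :
  computable k a -> computable k b -> computable k c -> computable k d ->
  computable k (fun xs => entry (a xs) (b xs) (c xs) (d xs)).
Proof.
move=> ca cb cc cd; have cn := computable_const k; apply: (computable_eq _ (cn 1)).
apply: (computable_digit (cn 2) _ cd); apply: (computable_digit _ cb cc).
exact: computable_exp (cn 2) ca.
Qed.

(** The base-[n] digits of [m] are the values of a parent function; fewer than [n] iterations reach
    its whole orbit. *)
Definition ancestor n m i j := [exists k : 'I_n, iter k (digit n m) i == j].

Lemma computable_ancestor k a b c d :
  computable k a -> computable k b -> computable k c -> computable k d ->
  computable k (fun xs => ancestor (a xs) (b xs) (c xs) (d xs)).
Proof.
move=> ca cb cc cd.
apply: (computable_exists (p := fun i xs => iter i (digit (a xs) (b xs)) (c xs) == d xs) ca).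
apply: computable_eq (computable_behead cd).
apply: (computable_iter (g := fun z ys => digit (a (behead ys)) (b (behead ys)) z)).
- exact: computable_head.
- exact: computable_behead.
apply: computable_digit (computable_head _);
  exact: (@computable_behead _ (fun ys => _ (behead ys)) (computable_behead _)).
Qed.

Definition normal_code m n c r : bool :=
  [&& digit n m r == r,
      [forall i : 'I_n, (i == r :> nat) || entry n c i (digit n m i)],
      [forall i : 'I_n, ancestor n m i r] &
      [forall i : 'I_n, [forall j : 'I_n,
         [|| ~~ entry n c i j, ancestor n m i j | ancestor n m j i]]]].

Lemma computable_normal_code k a b c d :
  computable k a -> computable k b -> computable k c -> computable k d ->
  computable k (fun xs => normal_code (a xs) (b xs) (c xs) (d xs)).
Proof.
(* The suffixes 1 and 2 mark the same functions under one and two bound variables. *)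
move=> ca cb cc cd; have ch := computable_head.
have [ca1 cb1 cc1 cd1] := And4 (computable_behead ca) (computable_behead cb)
  (computable_behead cc) (computable_behead cd).
have [ca2 cb2 cc2] := And3 (computable_behead ca1) (computable_behead cb1) (computable_behead cc1).
apply: computable_and (computable_eq (computable_digit cb ca cd) cd) _.
apply: computable_and.
  apply: (computable_forall (p := fun i xs => (i == d xs)
    || entry (b xs) (c xs) i (digit (b xs) (a xs) i)) cb).
  apply: computable_or (computable_eq (ch k) cd1) _.
  exact: computable_entry cb1 cc1 (ch k) (computable_digit cb1 ca1 (ch k)).
apply: computable_and.
  apply: (computable_forall (p := fun i xs => ancestor (b xs) (a xs) i (d xs)) cb).
  exact: computable_ancestor cb1 ca1 (ch k) cd1.
apply: (computable_forall (p := fun i xs => [forall j : 'I_(b xs),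
  [|| ~~ entry (b xs) (c xs) i j, ancestor (b xs) (a xs) i j | ancestor (b xs) (a xs) j i]]) cb).
apply: (computable_forall (p := fun j ys => [||
  ~~ entry (b (behead ys)) (c (behead ys)) (head 0 ys) j,
  ancestor (b (behead ys)) (a (behead ys)) (head 0 ys) j
  | ancestor (b (behead ys)) (a (behead ys)) j (head 0 ys)]) cb1).
have ch1 := computable_behead (ch k).
apply: computable_or (computable_neg (computable_entry cb2 cc2 ch1 (ch _))) _.
apply: computable_or; first exact: computable_ancestor cb2 ca2 ch1 (ch _).
exact: computable_ancestor cb2 ca2 (ch _) ch1.
Qed.

Definition tree_code m n : nat :=
  \sum_(i < n) (\sum_(j < n)
    ((i != j :> nat) && ((digit n m i == j) || (digit n m j == i)) : nat) * 2 ^ j)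
    * (2 ^ n) ^ i.

Lemma computable_tree_code k a b : computable k a -> computable k b ->
  computable k (fun xs => tree_code (a xs) (b xs)).
Proof.
move=> ca cb; have [ch c2] := (computable_head, fun k => computable_const k 2).
have [ca1 cb1] := (computable_behead ca, computable_behead cb).
have [ca2 cb2] := (computable_behead ca1, computable_behead cb1).
apply: (computable_sum (F := fun i xs => (\sum_(j < b xs)
  ((i != j :> nat) && ((digit (b xs) (a xs) i == j) || (digit (b xs) (a xs) j == i)) : nat)
    * 2 ^ j) * (2 ^ b xs) ^ i) cb).
apply: computable_mul; last exact: computable_exp (computable_exp (c2 _) cb1) (ch k).
apply: (computable_sum (F := fun j ys => ((head 0 ys != j) &&
  ((digit (b (behead ys)) (a (behead ys)) (head 0 ys) == j)
   || (digit (b (behead ys)) (a (behead ys)) j == head 0 ys)) : nat) * 2 ^ j) cb1).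
apply: computable_mul; last exact: computable_exp (c2 _) (ch _).
have ch1 := computable_behead (ch k).
apply: computable_and (computable_neg (computable_eq ch1 (ch _))) _.
apply: computable_or.
  exact: computable_eq (computable_digit cb2 ca2 ch1) (ch _).
exact: computable_eq (computable_digit cb2 ca2 (ch _)) ch1.
Qed.

(** * Correctness of the codes *)

Lemma digit_sum B m (a : 'I_m -> nat) (k : 'I_m) :
  (forall i, a i < B) -> digit B (\sum_(i < m) a i * B ^ i) k = a k.
Proof.
elim: m a k => [|m IHm] a k aB; first by case: k.
have B_gt0 : 0 < B := leq_ltn_trans (leq0n _) (aB k).
rewrite big_ord_recl muln1.
under eq_bigr => i _ do rewrite lift0 expnSr mulnA.
rewrite -big_distrl addnC /digit /=.
case: (unliftP ord0 k) => [j ->|->] /=; last by rewrite divn1 modnMDl modn_small.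
rewrite /bump add1n expnS divnMA divnMDl // (divn_small (aB ord0)) addn0.
exact: (IHm (fun i => a (lift ord0 i))).
Qed.

(** Applied to bits, this makes a matrix row a legitimate digit in base [2 ^ #|V|]. *)
Lemma sum_digits_lt B m (a : 'I_m -> nat) :
  (forall i, a i < B) -> \sum_(i < m) a i * B ^ i < B ^ m.
Proof.
elim: m a => [|m IHm] a aB; first by rewrite big_ord0.
rewrite big_ord_recr /= -addSn expnS.
have lt_S := IHm (fun i => a (widen_ord (leqnSn m) i)) (fun i => aB _).
apply: leq_trans (leq_add lt_S (leqnn _)) _.
by rewrite -mulSn leq_mul2r aB orbT.
Qed.

Section Codes.

Variable V : finType.
Local Notation rank := (@enum_rank V).
Implicit Types (e : rel V) (f : V -> V) (x y : V).

Lemma graph_codeE e : graph_code e =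
  \sum_(i < #|V|) (\sum_(j < #|V|) e (enum_val i) (enum_val j) * 2 ^ j) * (2 ^ #|V|) ^ i.
Proof.
rewrite /graph_code (reindex (@enum_val V V)) /=; last exact/onW_bij/enum_val_bij.
apply: eq_bigr => i _; rewrite big_mkcond (reindex (@enum_val V V)) /=;
  last exact/onW_bij/enum_val_bij.
rewrite big_distrl; apply: eq_bigr => j _ /=; rewrite !enum_valK.
by case: e; rewrite ?mul0n // mul1n -expnM -expnD addnC mulnC.
Qed.

Lemma entry_graph_code e x y : entry #|V| (graph_code e) (rank x) (rank y) = e x y.
Proof.
rewrite /entry graph_codeE digit_sum => [|i].
  rewrite (digit_sum (a := fun j => nat_of_bool (e (enum_val (rank x)) (enum_val j)))) => [|j].
    by rewrite !enum_rankK; case: e.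
  by case: e.
by apply: sum_digits_lt => j; case: e.
Qed.

Lemma forall_enum_rank (P : pred nat) :
  [forall i : 'I_#|V|, P i] = [forall x : V, P (rank x)].
Proof.
apply/forallP/forallP => PP i; first exact: PP.
by rewrite -(enum_valK i).
Qed.

(** Only the lowest [#|V|] digits matter, so a function has many codes. *)
Definition codes m f := forall x, digit #|V| m (rank x) = rank (f x).

Lemma exists_code f : exists m, codes m f.
Proof.
exists (\sum_(i < #|V|) rank (f (enum_val i)) * #|V| ^ i) => x.
by rewrite (digit_sum (a := fun i => rank (f (enum_val i)))) ?enum_rankK.
Qed.

(** The vertex [v] makes the base positive, so every digit is the rank of a vertex. *)
Lemma exists_coded m : V -> exists f, codes m f.
Proof.
move=> v; have V_gt0 : 0 < #|V| by apply/card_gt0P; exists v.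
exists (fun x => enum_val (Ordinal (ltn_pmod (m %/ #|V| ^ rank x) V_gt0))) => x.
by rewrite enum_valK.
Qed.

Section Coded.

Variables (m : nat) (f : V -> V).
Hypothesis mf : codes m f.

Lemma rank_eq x y : (rank x == rank y :> nat) = (x == y).
Proof. by rewrite (inj_eq (@ord_inj _)) (inj_eq enum_rank_inj). Qed.

Lemma ancestor_code x y : ancestor #|V| m (rank x) (rank y) = fconnect f x y.
Proof.
have itE k : iter k (digit #|V| m) (rank x) = rank (iter k f x).
  by elim: k => //= k ->; rewrite mf.
apply/existsP/idP => [[k]|fxy].
  by rewrite itE rank_eq => /eqP <-; apply: fconnect_iter.
have ltk : findex f x y < #|V| := leq_trans (findex_max fxy) (max_card _).
by exists (Ordinal ltk); rewrite itE rank_eq iter_findex.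
Qed.

Lemma normal_codeE e v :
  normal_code m #|V| (graph_code e) (rank v) = normal_parent_function e v f.
Proof.
rewrite /normal_parent_function /parent_function -!andbA /normal_code mf rank_eq.
congr [&& _, _, _ & _].
- rewrite (forall_enum_rank (fun i => (i == rank v) || entry _ _ i (digit _ _ i))).
  by apply: eq_forallb => x; rewrite mf rank_eq entry_graph_code implybE negbK.
- rewrite (forall_enum_rank (fun i => ancestor _ _ i _)).
  by apply: eq_forallb => x; rewrite ancestor_code.
rewrite (forall_enum_rank (fun i => [forall j : 'I_#|V|, [|| ~~ entry _ _ i j, ancestor _ _ i j
  | ancestor _ _ j i]])).
apply: eq_forallb => x.
rewrite (forall_enum_rank (fun j => [|| ~~ entry _ _ _ j, ancestor _ _ _ j | ancestor _ _ j _])).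
by apply: eq_forallb => y; rewrite entry_graph_code !ancestor_code implybE.
Qed.

Lemma tree_codeE : tree_code m #|V| = graph_code (parent_tree f).
Proof.
rewrite graph_codeE; apply: eq_bigr => i _; congr (_ * _); apply: eq_bigr => j _.
have [[x ->] [y ->]] : (exists x, i = rank x) /\ (exists y, j = rank y).
  by split; [exists (enum_val i) | exists (enum_val j)]; rewrite enum_valK.
by rewrite !enum_rankK !mf !rank_eq.
Qed.

End Coded.

End Codes.

Theorem theorem3p2 :
  exists A : program,
  forall (V : finType) (e : rel V) (v : V),
    simple_graph e -> connected_graph e -> bipartite_graph e ->
    exists t : rel V,
      computes A [:: #|V|; graph_code e; nat_of_ord (enum_rank v)]
        (graph_code t) /\
      cotree_edge_alternating_spanning_tree e t (depth_labeling t v).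
Proof.
have var4 i (lti : i < 4) := computable_var lti.
have var2 i (lti : i < 2) := computable_var lti.
(* [Mu] stops at the first zero, hence the negation: [F] is 0 on normal codes and 1 on all others,
   which is why [val] is constantly 0 below. *)
have [F FP] := computable_neg (computable_normal_code
  (var4 0 isT) (var4 1 isT) (var4 2 isT) (var4 3 isT)).
have [O OP] := computable_tree_code (var2 0 isT) (var2 1 isT).
exists (Comp O [:: Mu F; Proj 0]) => V e v [esym _] conn _.
set c := graph_code e; set r := nat_of_ord _.
have ex_m : exists m, normal_code m #|V| c r.
  have [f fP] := exists_normal_parent_function v esym conn.
  by have [m mf] := exists_code f; exists m; rewrite (normal_codeE mf).
have [m mP m_min] := ex_minnP ex_m.
(* The least [m] need not be the code constructed above, but it codes some [f], and the test it
   passed says that this [f] is normal. *)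
have [f mf] := exists_coded m v.
have fP : normal_parent_function e v f by rewrite -(normal_codeE mf).
exists (parent_tree f); split; last first.
  split; last exact: normal_alternating.
  by case/andP: fP => fP _; apply: parent_tree_spanning fP esym.
rewrite -(tree_codeE mf).
apply: (@computes_comp _ _ _ [:: m; #|V|]); [by [] | | exact: OP].
case=> [|[|//]] _; last exact: computes_proj.
apply: (@computes_mu F [:: #|V|; c; r] m (fun=> 0)) => [m' lt_m'|].
  have := FP [:: m'; #|V|; c; r] erefl; rewrite /=.
  by case: (boolP (normal_code _ _ _ _)) => // /m_min; rewrite leqNgt lt_m'.
by have := FP [:: m; #|V|; c; r] erefl; rewrite /= mP.
Qed.
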